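(* Let $\mathcal{A}\in\mathbb{C}^{I_1\times\cdots\times I_N\times I_1\times\cdots\times I_N}$ be a nonzero tensor. Then, for the spectral norm $\|\cdot\|$, $$1\le\|\mathcal{A}\|\,\|\mathcal{A}^\dagger\|\le 4\,w(\mathcal{A})\,w(\mathcal{A}^\dagger).$$
   Context: For tensors $\mathcal{A},\mathcal{B}\in\mathbb{C}^{I_1\times\cdots\times I_N\times I_1\times\cdots\times I_N}$ the Einstein product is $(\mathcal{A}*_N\mathcal{B})_{i_1\ldots i_Nj_1\ldots j_N}=\sum_{k_1,\ldots,k_N}a_{i_1\ldots i_Nk_1\ldots k_N}b_{k_1\ldots k_Nj_1\ldots j_N}$, and for $\mathcal{X}\in\mathbb{C}^{I_1\times\cdots\times I_N}$, $(\mathcal{A}*_N\mathcal{X})_{i_1\ldots i_N}=\sum_{k_1,\ldots,k_N}a_{i_1\ldots i_Nk_1\ldots k_N}x_{k_1\ldots k_N}$. For $\mathcal{X},\mathcal{Y}\in\mathbb{C}^{I_1\times\cdots\times I_N}$, $\langle\mathcal{X},\mathcal{Y}\rangle=\sum_{i_1,\ldots,i_N}x_{i_1\ldots i_N}\overline{y_{i_1\ldots i_N}}$ and $\|\mathcal{X}\|=\langle\mathcal{X},\mathcal{X}\rangle^{1/2}$; the spectral norm of $\mathcal{A}$ is $\|\mathcal{A}\|=\sup\{\|\mathcal{A}*_N\mathcal{X}\|:\|\mathcal{X}\|=1\}$. The conjugate transpose is $(\mathcal{A}^H)_{i_1\ldots i_Nj_1\ldots j_N}=\overline{a_{j_1\ldots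 j_Ni_1\ldots i_N}}$. The Moore--Penrose inverse $\mathcal{A}^\dagger$ of $\mathcal{A}$ is the unique tensor $\mathcal{X}$ of the same size satisfying $\mathcal{A}*_N\mathcal{X}*_N\mathcal{A}=\mathcal{A}$, $\mathcal{X}*_N\mathcal{A}*_N\mathcal{X}=\mathcal{X}$, $(\mathcal{A}*_N\mathcal{X})^H=\mathcal{A}*_N\mathcal{X}$, $(\mathcal{X}*_N\mathcal{A})^H=\mathcal{X}*_N\mathcal{A}$. The numerical range is $W(\mathcal{A})=\{\langle\mathcal{A}*_N\mathcal{X},\mathcal{X}\rangle:\mathcal{X}\in\mathbb{C}^{I_1\times\cdots\times I_N},\|\mathcal{X}\|=1\}$ and the numerical radius is $w(\mathcal{A})=\max\{|z|:z\in W(\mathcal{A})\}$. *)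

(* Defs.v *)
From mathcomp Require Import all_boot all_order all_algebra.
From mathcomp Require Import complex.
From mathcomp Require Import all_classical all_reals.

Set Implicit Arguments.
Unset Strict Implicit.
Unset Printing Implicit Defensive.

Import Order.TTheory GRing.Theory Num.Theory.

Local Open Scope classical_set_scope.
Local Open Scope ring_scope.
Local Open Scope complex_scope.

Definition multi_index (N : nat) (I : 'I_N -> nat) : finType :=
  {dffun forall k : 'I_N, 'I_(I k)}.

Definition tensor (R : realType) (N : nat) (I : 'I_N -> nat) :=
  {ffun multi_index I -> R[i]}.

(* Elements of C^(I_1 x ... x I_N x I_1 x ... x I_N): the entry
   a_(i_1 ... i_N j_1 ... j_N) is A (i, j). *)
Definition sq_tensor (R : realType) (N : nat) (I : 'I_N -> nat) :=
  {ffun multi_index I * multi_index I -> R[i]}.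

Section Tensors.
Context {R : realType} {N : nat} {I : 'I_N -> nat}.
Implicit Types (A B : sq_tensor R I) (X Y : tensor R I).

Definition einstein_mul A B : sq_tensor R I :=
  [ffun ij => \sum_(k : multi_index I) A (ij.1, k) * B (k, ij.2)].

Definition einstein_app A X : tensor R I :=
  [ffun i => \sum_(k : multi_index I) A (i, k) * X k].

Definition conj_transpose A : sq_tensor R I :=
  [ffun ij => (A (ij.2, ij.1))^*].

Definition inner X Y : R[i] := \sum_(i : multi_index I) X i * (Y i)^*.

(* [inner X X] is a nonnegative real, so its real part loses nothing. *)
Definition tensor_norm X : R := Num.sqrt (complex.Re (inner X X)).

Definition spectral_norm A : R :=
  sup [set tensor_norm (einstein_app A X) | X in [set X | tensor_norm X = 1]].

Definition is_moore_penrose A B : Prop :=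
  [/\ einstein_mul (einstein_mul A B) A = A,
      einstein_mul (einstein_mul B A) B = B,
      conj_transpose (einstein_mul A B) = einstein_mul A B
    & conj_transpose (einstein_mul B A) = einstein_mul B A].

(* Definite description; the default value 0 is never used, since the
   Moore-Penrose inverse always exists and is unique. *)
Definition moore_penrose A : sq_tensor R I := xget 0 (is_moore_penrose A).

Definition numerical_range A : set R[i] :=
  [set inner (einstein_app A X) X | X in [set X | tensor_norm X = 1]].

(* The largest element of the set of moduli, as an attained maximum rather
   than a supremum; the default value 0 is used only when the set of moduli is
   empty (some dimension is 0). *)
Definition numerical_radius A : R :=
  let moduli : set R := [set Normc.normc z | z in numerical_range A] in
  xget 0 [set m | moduli m /\ ubound moduli m].

End Tensors.

(* Main.v *)
(* Polarization gives 4 <A X, Y> as a combination with unimodular coefficients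
   of <A Z, Z> for the four tensors Z = X + i^k Y, whose squared norms add up to
   4 (|X|^2 + |Y|^2); for unit X and Y = A X / |A X| this yields
   |A X| <= 2 w(A), and the upper bound follows by applying this to A and to its
   Moore-Penrose inverse B.  The lower bound comes from A = A B A, which gives
   |Y| = |A (B Y)| <= |A| |B| |Y| for any nonzero Y in the range of A.  The
   maximum defining w is attained by compactness of the unit sphere, and B
   is built from the row-space inclusion of M in M^H M. *)

Require Import Defs.
From mathcomp Require Import all_boot all_order all_algebra.
From mathcomp Require Import complex.
From mathcomp Require Import all_classical all_reals.
From mathcomp Require Import ring lra topology normedtype derive realfun.

Set Implicit Arguments.
Unset Strict Implicit.
Unset Printing Implicit Defensive.

Import Order.TTheory GRing.Theory Num.Theory.
Import numFieldNormedType.Exports.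

Local Open Scope ring_scope.
Local Open Scope complex_scope.

(** * Sesquilinear algebra of tensors, polarization, and the bound |A X| <= 2 w *)

Section TensorAlgebra.
Context {R : realType} {N : nat} {I : 'I_N -> nat}.
Implicit Types (A B : sq_tensor R I) (X Y U V : tensor R I) (c : R[i]).

Definition tscale c X : tensor R I := [ffun i => c * X i].

Lemma einstein_appM A B X :
  einstein_app (einstein_mul A B) X = einstein_app A (einstein_app B X).
Proof.
apply/ffunP => i; rewrite !ffunE.
under eq_bigr do rewrite ffunE mulr_suml.
rewrite exchange_big /=; apply: eq_bigr => k _.
by rewrite ffunE mulr_sumr; apply: eq_bigr => j _; rewrite mulrA.
Qed.

Lemma einstein_appD A X Y :
  einstein_app A (X + Y) = einstein_app A X + einstein_app A Y.
Proof.
apply/ffunP => i; rewrite !ffunE -big_split.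
by apply: eq_bigr => k _; rewrite ffunE mulrDr.
Qed.

Lemma einstein_appZ A c X : einstein_app A (tscale c X) = tscale c (einstein_app A X).
Proof.
apply/ffunP => i; rewrite !ffunE mulr_sumr.
by apply: eq_bigr => k _; rewrite ffunE mulrCA.
Qed.

Lemma innerDl X Y U : inner (X + Y) U = inner X U + inner Y U.
Proof. by rewrite -big_split; apply: eq_bigr => i _; rewrite ffunE mulrDl. Qed.

Lemma innerDr X Y U : inner U (X + Y) = inner U X + inner U Y.
Proof. by rewrite -big_split; apply: eq_bigr => i _; rewrite ffunE rmorphD mulrDr. Qed.

Lemma innerZl c X U : inner (tscale c X) U = c * inner X U.
Proof. by rewrite mulr_sumr; apply: eq_bigr => i _; rewrite ffunE mulrA. Qed.

Lemma innerZr c X U : inner U (tscale c X) = c^* * inner U X.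
Proof. by rewrite mulr_sumr; apply: eq_bigr => i _; rewrite ffunE rmorphM mulrCA. Qed.

Lemma inner_self X : inner X X = (tensor_norm X ^+ 2)%:C.
Proof.
have p : 0 <= inner X X by apply: sumr_ge0 => i _; exact: mul_conjC_ge0.
move: p; rewrite /tensor_norm; case: (inner X X) => a b.
by rewrite lecE /= => /andP[/eqP b0 a0]; rewrite b0 sqr_sqrtr.
Qed.

Lemma tensor_norm_ge0 X : 0 <= tensor_norm X.
Proof. exact: sqrtr_ge0. Qed.

Lemma tensor_norm_eq0 X : tensor_norm X = 0 -> X = 0.
Proof.
move=> h; have /eqP : inner X X = 0 by rewrite inner_self h expr0n.
rewrite psumr_eq0 => [|i _]; last exact: mul_conjC_ge0.
by move=> /allP h0; apply/ffunP => i; rewrite ffunE; apply/eqP;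
  rewrite -mul_conjC_eq0; apply: h0; rewrite mem_index_enum.
Qed.

Lemma tensor_normZ c X : tensor_norm (tscale c X) = Normc.normc c * tensor_norm X.
Proof.
apply/eqP; rewrite -(eqrXn2 (n := 2)) ?tensor_norm_ge0 ?mulr_ge0 ?tensor_norm_ge0 //;
  last by case: c => a b; exact: sqrtr_ge0.
rewrite -(inj_eq (@complexI R)) -inner_self innerZl innerZr mulrA -normCK inner_self.
by rewrite -[`|c|]/((Normc.normc c)%:C) -rmorphXn -rmorphM exprMn.
Qed.


Lemma tensor_normZ_ge0 (r : R) X :
  0 <= r -> tensor_norm (tscale r%:C X) = r * tensor_norm X.
Proof. by move=> r0; rewrite tensor_normZ /= expr0n addr0 sqrtr_sqr ger0_norm. Qed.

Lemma einstein_app0 A : einstein_app A 0 = 0.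
Proof. by apply/ffunP => i; rewrite !ffunE big1 // => k _; rewrite ffunE mulr0. Qed.

Lemma tensor_norm0 : tensor_norm (0 : tensor R I) = 0.
Proof. by rewrite /tensor_norm /inner big1 ?sqrtr0 // => i _; rewrite ffunE mul0r. Qed.

Lemma exists_unit_tensor X : X != 0 ->
  exists2 U, tensor_norm U = 1 & X = tscale (tensor_norm X)%:C U.
Proof.
move=> X0; have n0 : tensor_norm X != 0 by apply: contra_neq X0; exact: tensor_norm_eq0.
exists (tscale (tensor_norm X)^-1%:C X).
  by rewrite tensor_normZ_ge0 ?invr_ge0 ?tensor_norm_ge0 // mulVf.
by apply/ffunP => i; rewrite !ffunE mulrA -rmorphM mulfV // mul1r.
Qed.

(** Over the four units c, the coefficients c, c^2 and c |c|^2 of the unwanted terms sum to 0, while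
    |c|^2 sums to 4. *)
Lemma polarization A X Y (i : R[i]) : i ^+ 2 = -1 -> i^* = - i ->
  4 * inner (einstein_app A X) Y =
  \sum_(c <- [:: 1; -1; i; -i])
    c * inner (einstein_app A (X + tscale c Y)) (X + tscale c Y).
Proof.
move=> i2 iJ.
(* Naming the conjugate [d] leaves a polynomial identity, which [ring] can check from [i2] alone. *)
have E c d : c^* = d ->
    inner (einstein_app A (X + tscale c Y)) (X + tscale c Y) =
    inner (einstein_app A X) X + d * inner (einstein_app A X) Y +
    c * inner (einstein_app A Y) X + c * d * inner (einstein_app A Y) Y.
  move=> <-; rewrite einstein_appD einstein_appZ !(innerDl, innerDr, innerZl, innerZr).
  by ring.
rewrite !big_cons big_nil (E 1 1 (rmorph1 _)) (E (-1) (-1) (rmorphN1 _)) (E i (-i) iJ).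
rewrite (E (-i) i); last by rewrite rmorphN /= iJ opprK.
by ring: i2.
Qed.

Lemma sum_sqr_tensor_norm X Y (i : R[i]) : i ^+ 2 = -1 -> i^* = - i ->
  \sum_(c <- [:: 1; -1; i; -i]) tensor_norm (X + tscale c Y) ^+ 2 =
  4 * (tensor_norm X ^+ 2 + tensor_norm Y ^+ 2).
Proof.
move=> i2 iJ; apply: (@complexI R).
have E c d : c^* = d -> (tensor_norm (X + tscale c Y) ^+ 2)%:C =
    inner X X + d * inner X Y + c * inner Y X + c * d * inner Y Y.
  by move=> <-; rewrite -inner_self !(innerDl, innerDr, innerZl, innerZr); ring.
have nat4 : (4 : R)%:C = 4 by exact: (rmorph_nat (real_complex R)).
rewrite rmorph_sum rmorphM (rmorphD _ (tensor_norm X ^+ 2)) /= nat4.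
rewrite -!inner_self !big_cons big_nil.
rewrite (E 1 1 (rmorph1 _)) (E (-1) (-1) (rmorphN1 _)) (E i (-i) iJ).
rewrite (E (-i) i); last by rewrite rmorphN /= iJ opprK.
by ring: i2.
Qed.

(** Homogeneity: scaling Z by a real r multiplies the quadratic form by r^2. *)
Lemma normc_inner_le A (w : R) :
  (forall Z, tensor_norm Z = 1 -> Normc.normc (inner (einstein_app A Z) Z) <= w) ->
  forall Z, Normc.normc (inner (einstein_app A Z) Z) <= w * tensor_norm Z ^+ 2.
Proof.
move=> hw Z; have [->|/exists_unit_tensor[U U1 ->]] := eqVneq Z 0.
  rewrite tensor_norm0 expr0n mulr0 /inner big1 ?Normc.normc0 // => i _.
  by rewrite [X in _ * X^*]ffunE conjC0 mulr0.
rewrite tensor_normZ_ge0 ?tensor_norm_ge0 // U1 mulr1.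
set r := tensor_norm Z.
rewrite einstein_appZ innerZl innerZr mulrA !Normc.normcM mulrC.
have -> : Normc.normc (r%:C) * Normc.normc ((r%:C)^*) = r ^+ 2.
  by rewrite /= oppr0 expr0n addr0 sqrtr_sqr ger0_norm ?tensor_norm_ge0.
by rewrite ler_wpM2r ?sqr_ge0 ?hw.
Qed.

Lemma tensor_norm_app_le A (w : R) X :
  (forall Z, tensor_norm Z = 1 -> Normc.normc (inner (einstein_app A Z) Z) <= w) ->
  tensor_norm X = 1 -> tensor_norm (einstein_app A X) <= 2 * w.
Proof.
move=> hw X1.
have w0 : 0 <= w by apply: le_trans (hw _ X1); case: inner => a b; exact: sqrtr_ge0.
have [->|AX0] := eqVneq (einstein_app A X) 0; first by rewrite tensor_norm0 mulr_ge0.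
have [Y Y1 AXY] := exists_unit_tensor AX0.
have i2 : 'i%C ^+ 2 = -1 :> R[i] by exact: sqr_i.
have iJ : ('i%C : R[i])^* = - 'i%C by apply/eqP; rewrite eq_complex /= oppr0 !eqxx.
(* The four squared norms add up to 4 (1 + 1) = 8, so 4 |A X| <= 8 w. *)
have : `|4 * inner (einstein_app A X) Y| <= (w * 8)%:C.
  have -> : (8 : R) = \sum_(c <- [:: 1; -1; 'i; -'i : R[i]]) tensor_norm (X + tscale c Y) ^+ 2.
    by rewrite sum_sqr_tensor_norm // X1 Y1; ring.
  rewrite (polarization _ _ _ i2 iJ) mulr_sumr rmorph_sum.
  apply: le_trans (ler_norm_sum _ _ _) _.
  rewrite !big_seq; apply: ler_sum => c hc; rewrite normrM.
  have -> : `|c| = 1.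
    move: hc; rewrite !inE => /or4P[] /eqP ->; rewrite ?normrN ?normr1 //;
    by rewrite normc_def /= expr0n expr1n add0r sqrtr1.
  by rewrite mul1r lecR; exact: normc_inner_le.
(* Y is A X normalized, so this inner product is the norm to be bounded. *)
have -> : inner (einstein_app A X) Y = (tensor_norm (einstein_app A X))%:C.
  by rewrite {1}AXY innerZl inner_self Y1 expr1n mulr1.
have -> : (4 : R[i]) = (4 : R)%:C by exact/esym/(rmorph_nat (real_complex R)).
rewrite -rmorphM ger0_norm lecR ?mulr_ge0 ?tensor_norm_ge0 //.
by lra.
Qed.

End TensorAlgebra.

(** * Continuity of complex-valued maps *)

Section ComplexContinuity.
Context {R : realType} {T : topologicalType}.
Implicit Types F G : T -> R[i].

(* The structure [R[i]] is not used as a topological space here: continuity is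
   that of the real and imaginary parts. *)
Definition ccontinuous F :=
  continuous (fun v => complex.Re (F v) : R) /\ continuous (fun v => complex.Im (F v) : R).

Lemma ccontinuous_cst (c : R[i]) : ccontinuous (fun=> c).
Proof. by split=> v; exact: cst_continuous. Qed.

Lemma ccontinuousD F G : ccontinuous F -> ccontinuous G -> ccontinuous (fun v => F v + G v).
Proof.
move=> [F1 F2] [G1 G2]; split=> v.
  under [X in continuous_at _ X]eq_fun do rewrite raddfD.
  by apply: cvgD; [exact: F1|exact: G1].
under [X in continuous_at _ X]eq_fun do rewrite raddfD.
by apply: cvgD; [exact: F2|exact: G2].
Qed.

Lemma ccontinuousM F G : ccontinuous F -> ccontinuous G -> ccontinuous (fun v => F v * G v).
Proof.
have ReM (x y : R[i]) : complex.Re (x * y) =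
    complex.Re x * complex.Re y - complex.Im x * complex.Im y by case: x y => [a b] [c d].
have ImM (x y : R[i]) : complex.Im (x * y) =
    complex.Re x * complex.Im y + complex.Im x * complex.Re y by case: x y => [a b] [c d].
move=> [F1 F2] [G1 G2]; split=> v.
  under [X in continuous_at _ X]eq_fun do rewrite ReM.
  by apply: cvgB; apply: cvgM; [exact: F1|exact: G1|exact: F2|exact: G2].
under [X in continuous_at _ X]eq_fun do rewrite ImM.
by apply: cvgD; apply: cvgM; [exact: F1|exact: G2|exact: F2|exact: G1].
Qed.

Lemma ccontinuous_conj F : ccontinuous F -> ccontinuous (fun v => (F v)^*%R).
Proof.
have ReJ (x : R[i]) : complex.Re (x^*)%R = complex.Re x by case: x.
have ImJ (x : R[i]) : complex.Im (x^*)%R = - complex.Im x by case: x.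
move=> [F1 F2]; split=> v.
  under [X in continuous_at _ X]eq_fun do rewrite ReJ.
  exact: F1.
under [X in continuous_at _ X]eq_fun do rewrite ImJ.
by apply: cvgN; exact: F2.
Qed.

Lemma ccontinuous_sum (J : finType) (F : J -> T -> R[i]) :
  (forall j, ccontinuous (F j)) -> ccontinuous (fun v => \sum_j F j v).
Proof.
move=> hF; elim: index_enum => [|j s ih].
  under [X in ccontinuous X]eq_fun do rewrite big_nil.
  exact: ccontinuous_cst.
under [X in ccontinuous X]eq_fun do rewrite big_cons.
exact: ccontinuousD.
Qed.

Lemma continuous_normc F : ccontinuous F -> continuous (fun v => Normc.normc (F v) : R).
Proof.
move=> [F1 F2] v.
have E (z : R[i]) : Normc.normc z = Num.sqrt (complex.Re z ^+ 2 + complex.Im z ^+ 2) by case: z.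
under [X in continuous_at _ X]eq_fun do rewrite E.
apply: continuous_comp; last exact: sqrt_continuous.
by apply: cvgD; apply: cvgM; (exact: F1 || exact: F2).
Qed.

End ComplexContinuity.

(** * Compactness of the unit sphere and attainment of the numerical radius *)

Section Coordinates.
Context {R : realType} {N : nat} {I : 'I_N -> nat}.
Implicit Types (A B : sq_tensor R I) (X Y : tensor R I).
Notation coords := 'rV[R]_#|{: multi_index I * bool}|.

(** Real coordinates, the boolean selecting the imaginary part, make compactness of boxes in real
    row vectors available. *)
Definition of_coords (v : coords) : tensor R I :=
  [ffun t => v 0 (enum_rank (t, false)) +i* v 0 (enum_rank (t, true))].

Definition to_coords X : coords :=
  \row_j if (enum_val j).2 then complex.Im (X (enum_val j).1)
         else complex.Re (X (enum_val j).1).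

Lemma to_coordsK : cancel to_coords of_coords.
Proof.
by move=> X; apply/ffunP => t; rewrite ffunE !mxE !enum_rankK /=; case: (X t).
Qed.

Lemma ccontinuous_coord t : ccontinuous (fun v => of_coords v t).
Proof.
split=> v.
  under [X in continuous_at _ X]eq_fun do rewrite ffunE.
  exact: coord_continuous.
under [X in continuous_at _ X]eq_fun do rewrite ffunE.
exact: coord_continuous.
Qed.

Lemma ccontinuous_inner (F G : coords -> tensor R I) :
  (forall t, ccontinuous (fun v => F v t)) -> (forall t, ccontinuous (fun v => G v t)) ->
  ccontinuous (fun v => inner (F v) (G v)).
Proof.
move=> hF hG; apply: ccontinuous_sum => t; apply: ccontinuousM => //.
exact: ccontinuous_conj.
Qed.

Lemma ccontinuous_app A t : ccontinuous (fun v => einstein_app A (of_coords v) t).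
Proof.
under [X in ccontinuous X]eq_fun do rewrite ffunE.
apply: ccontinuous_sum => k; apply: ccontinuousM; first exact: ccontinuous_cst.
exact: ccontinuous_coord.
Qed.

Lemma Re_inner_self X :
  complex.Re (inner X X) = \sum_t (complex.Re (X t) ^+ 2 + complex.Im (X t) ^+ 2).
Proof.
rewrite raddf_sum; apply: eq_bigr => t _; case: (X t) => a b /=.
by rewrite mulrN opprK !expr2.
Qed.

(** The sphere is a closed subset of the cube [-1, 1]^n. *)
Lemma compact_unit_sphere :
  compact [set v : coords | tensor_norm (of_coords v) = 1]%classic.
Proof.
have cN : ccontinuous (fun v => inner (of_coords v) (of_coords v)).
  by apply: ccontinuous_inner; exact: ccontinuous_coord.
have E v : tensor_norm (of_coords v) = 1 <->
    complex.Re (inner (of_coords v) (of_coords v)) = 1.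
  by split=> h; [rewrite inner_self h expr1n | rewrite /tensor_norm h sqrtr1].
apply: (@subclosed_compact _ _ [set v : coords | forall j, `[-1, 1]%classic (v ord0 j)]).
- rewrite (_ : mkset _ = (fun v => complex.Re (inner (of_coords v) (of_coords v)))
       @^-1` [set x | x = 1])%classic.
    by apply: preimage_closed; [move=> v _; exact: cN.1 | exact: closed_eq].
  by apply/seteqP; split=> v /= /E.
- by apply: (@rV_compact R _ (fun=> `[-1, 1]%classic)) => _; exact: segment_compact.
move=> v /= /E h j.
rewrite /= in_itv /= -ler_norml -(@expr_le1 _ 2) // real_normK ?num_real //.
rewrite -[j]enum_valK; case: (enum_val j) => t b.
(* The square of one coordinate is at most |x_t|^2, itself one term of a sum of nonnegative terms
   equal to 1. *)
apply: le_trans (_ : complex.Re (of_coords v t) ^+ 2 + complex.Im (of_coords v t) ^+ 2 <= _).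
  by rewrite ffunE; case: b; rewrite ?lerDl ?lerDr sqr_ge0.
rewrite -h Re_inner_self (bigD1 t) //= lerDl.
by apply: sumr_ge0 => k _; rewrite addr_ge0 ?sqr_ge0.
Qed.

(** [X0] certifies that the sphere is nonempty, which fails if some dimension is 0. *)
Lemma numerical_radius_attained A X0 : tensor_norm X0 = 1 ->
  exists2 X, tensor_norm X = 1 & forall Y, tensor_norm Y = 1 ->
    Normc.normc (inner (einstein_app A Y) Y) <= Normc.normc (inner (einstein_app A X) X).
Proof.
move=> X01.
have cQ : ccontinuous (fun v => inner (einstein_app A (of_coords v)) (of_coords v)).
  by apply: ccontinuous_inner; [exact: ccontinuous_app|exact: ccontinuous_coord].
pose f v : R := Normc.normc (inner (einstein_app A (of_coords v)) (of_coords v)).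
have [| |v + max_v] := @compact_EVT_max _ R f _ _ compact_unit_sphere.
- by exists (to_coords X0); rewrite /= to_coordsK.
- by apply: continuous_subspaceT; exact: continuous_normc.
rewrite inE /= => v1; exists (of_coords v) => // Y Y1.
by have := max_v (to_coords Y); rewrite inE /f /= to_coordsK; exact.
Qed.
End Coordinates.

(** * Existence of the Moore-Penrose inverse of a matrix *)

Section MatrixMoorePenrose.
Context {C : numClosedFieldType}.

Local Notation "M ^H" := (map_mx Num.conj M)^T (at level 8, format "M ^H").

Lemma adjmxK m n (M : 'M[C]_(m, n)) : M^H^H = M.
Proof. by apply/matrixP => i j; rewrite !mxE conjCK. Qed.

Lemma adjmxM m n p (M : 'M[C]_(m, n)) (P : 'M[C]_(n, p)) : (M *m P)^H = P^H *m M^H.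
Proof. by rewrite map_mxM trmx_mul. Qed.

(** The j-th diagonal entry of M^H M is the sum of the squared moduli in column j of M. *)
Lemma adjmx_mul_eq0 m n (M : 'M[C]_(m, n)) : M^H *m M = 0 -> M = 0.
Proof.
move=> M0; apply/matrixP => i j; rewrite mxE.
have /eqP := congr1 (fun P : 'M_n => P j j) M0; rewrite !mxE psumr_eq0.
  by move=> /allP/(_ i (mem_index_enum _)); rewrite !mxE mulrC mul_conjC_eq0 => /eqP.
by move=> k _; rewrite !mxE mulrC mul_conjC_ge0.
Qed.

(** If K is the cokernel of M^H M, then (M K)^H (M K) = K^H (M^H M K) = 0, hence M K = 0. *)
Lemma submx_adj_mul m n (M : 'M[C]_(m, n)) : (M <= M^H *m M)%MS.
Proof.
rewrite submxE; apply/eqP/adjmx_mul_eq0.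
by rewrite adjmxM -mulmxA (mulmxA M^H) mulmx_coker mulmx0.
Qed.

(* M = D M^H M makes D^H a {1,3}-inverse of M. *)
Lemma exists_least_squares_inverse m n (M : 'M[C]_(m, n)) :
  exists2 X : 'M[C]_(n, m), M *m X *m M = M & (M *m X)^H = M *m X.
Proof.
have /submxP[D MD] := submx_adj_mul M.
have herm : (M *m D^H)^H = M *m D^H.
  have -> : M *m D^H = D *m (M^H *m M) *m D^H by rewrite -MD.
  by rewrite !adjmxM !adjmxK !mulmxA.
exists D^H => //.
by rewrite -herm adjmxM adjmxK -mulmxA -MD.
Qed.

Lemma exists_moore_penrose_mx m n (M : 'M[C]_(m, n)) :
  exists P : 'M[C]_(n, m), [/\ M *m P *m M = M, P *m M *m P = P,
    (M *m P)^H = M *m P & (P *m M)^H = P *m M].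
Proof.
have [X MXM MX] := exists_least_squares_inverse M.
have [Z MZM MZ] := exists_least_squares_inverse M^H.
(* The Moore-Penrose inverse is Y M X with X a {1,3}-inverse of M and Y a
   {1,4}-inverse, obtained as the adjoint of a {1,3}-inverse of M^H. *)
pose Y := Z^H.
have MYM : M *m Y *m M = M by rewrite -{3}[M]adjmxK -MZM !adjmxM adjmxK mulmxA.
have YME : Y *m M = M^H *m Z by rewrite -MZ adjmxM adjmxK.
have YM : (Y *m M)^H = Y *m M by rewrite YME MZ.
(* With P = Y M X, M P = M X and P M = Y M, so P inherits one Hermitian condition from X and the
   other from Y. *)
have MP : M *m (Y *m M *m X) = M *m X by rewrite !mulmxA MYM.
have PM : Y *m M *m X *m M = Y *m M by rewrite -!mulmxA (mulmxA M) MXM.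
exists (Y *m M *m X); split; rewrite ?MP ?PM //.
by rewrite -mulmxA MP mulmxA.
Qed.

End MatrixMoorePenrose.

(** * Transfer to tensors, and bounds on the spectral norm *)

Section Norms.
Context {R : realType} {N : nat} {I : 'I_N -> nat}.
Implicit Types (A B : sq_tensor R I) (X Y : tensor R I).
Notation mx := 'M[R[i]]_#|{: multi_index I}|.

Definition mx_of_tensor A : mx := \matrix_(i, j) A (enum_val i, enum_val j).

Definition tensor_of_mx (M : mx) : sq_tensor R I :=
  [ffun ij => M (enum_rank ij.1) (enum_rank ij.2)].

Lemma mx_of_tensorK : cancel mx_of_tensor tensor_of_mx.
Proof. by move=> A; apply/ffunP => -[i j]; rewrite ffunE mxE !enum_rankK. Qed.

Lemma tensor_of_mxM (M P : mx) :
  tensor_of_mx (M *m P) = einstein_mul (tensor_of_mx M) (tensor_of_mx P).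
Proof.
apply/ffunP => -[i j]; rewrite !ffunE mxE (reindex enum_rank) /=.
  by apply: eq_bigr => k _; rewrite !ffunE.
by apply: onW_bij; exact: enum_rank_bij.
Qed.

Lemma tensor_of_mx_adj (M : mx) :
  tensor_of_mx (map_mx Num.conj M)^T = conj_transpose (tensor_of_mx M).
Proof. by apply/ffunP => ij; rewrite !ffunE !mxE. Qed.

(** Existence suffices for [xget]; flattening multi-indices to ordinals carries the matrix inverse
    over to tensors. *)
Lemma moore_penroseP A : is_moore_penrose A (moore_penrose A).
Proof.
apply: xgetPex; have [P [MPM PMP MP PM]] := exists_moore_penrose_mx (mx_of_tensor A).
exists (tensor_of_mx P); rewrite -[A]mx_of_tensorK.
by split; rewrite -!tensor_of_mxM -?tensor_of_mx_adj ?MPM ?PMP ?MP ?PM.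
Qed.

Lemma normc_inner_le_numerical_radius A X : tensor_norm X = 1 ->
  Normc.normc (inner (einstein_app A X) X) <= numerical_radius A.
Proof.
move=> X1; have [X0 X01 X0max] := numerical_radius_attained A X1.
(* An attained maximum exists, so [xget] returns it and not its default 0. *)
have [_ ub] : [set m | [set Normc.normc z | z in numerical_range A]%classic m /\
    ubound [set Normc.normc z | z in numerical_range A]%classic m]%classic
    (numerical_radius A).
  apply: xgetPex; exists (Normc.normc (inner (einstein_app A X0) X0)); split.
    by exists (inner (einstein_app A X0) X0) => //; exists X0.
  by move=> _ [_ [Y Y1 <-] <-]; exact: X0max.
by apply: ub; exists (inner (einstein_app A X) X) => //; exists X.
Qed.

Lemma spectral_norm_ub A :
  ubound [set tensor_norm (einstein_app A X) | X in [set X | tensor_norm X = 1]]%classic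
    (2 * numerical_radius A).
Proof.
move=> _ [X X1 <-]; apply: tensor_norm_app_le => // Z.
exact: normc_inner_le_numerical_radius.
Qed.

Lemma spectral_norm_le A X : tensor_norm X = 1 ->
  spectral_norm A <= 2 * numerical_radius A.
Proof.
move=> X1; apply: ge_sup; last exact: spectral_norm_ub.
by exists (tensor_norm (einstein_app A X)); exists X.
Qed.

Lemma tensor_norm_app A X :
  tensor_norm (einstein_app A X) <= spectral_norm A * tensor_norm X.
Proof.
have [->|/exists_unit_tensor[U U1 ->]] := eqVneq X 0.
  by rewrite einstein_app0 tensor_norm0 mulr0.
rewrite einstein_appZ !tensor_normZ_ge0 ?tensor_norm_ge0 // U1 mulr1 mulrC.
rewrite ler_wpM2r ?tensor_norm_ge0 //; apply: ub_le_sup; last by exists U.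
(* A supremum dominates its set only if that set is bounded above; 2 w(A) is such a bound. *)
by exists (2 * numerical_radius A); exact: spectral_norm_ub.
Qed.

Lemma spectral_norm_ge0 A X : tensor_norm X = 1 -> 0 <= spectral_norm A.
Proof.
move=> X1; apply: le_trans (tensor_norm_ge0 (einstein_app A X)) _.
by have := tensor_norm_app A X; rewrite X1 mulr1.
Qed.

Lemma exists_app_neq0 A : A <> 0 -> exists X, einstein_app A X != 0.
Proof.
move=> A0; apply: contrapT => h; apply: A0; apply/ffunP => -[i j]; rewrite [RHS]ffunE.
(* The indicator tensor of j extracts column j of A, whose entry at i is nonzero. *)
apply: contrapT => Aij; apply: h; exists [ffun k => (k == j)%:R].
apply/eqP => /ffunP/(_ i); rewrite !ffunE (bigD1 j) //= ffunE eqxx mulr1 big1.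
  by rewrite addr0.
by move=> k /negbTE kj; rewrite ffunE kj mulr0.
Qed.

End Norms.

Theorem theorem5p9 (R : realType) (N : nat) (I : 'I_N -> nat)
    (A : sq_tensor R I) (hA : A <> 0) :
  1 <= spectral_norm A * spectral_norm (moore_penrose A)
    <= 4 * numerical_radius A * numerical_radius (moore_penrose A).
Proof.
have [X AX0] := exists_app_neq0 hA.
(* Some unit tensor exists; this is what makes both spectral norms nonnegative and bounded by 2
   w. *)
have [U U1 _] := exists_unit_tensor AX0.
have [ABA _ _ _] := moore_penroseP A.
set B := moore_penrose A in ABA *.
apply/andP; split.
  have Y0 : 0 < tensor_norm (einstein_app A X).
    rewrite lt_def tensor_norm_ge0 andbT.
    by apply: contra_neq AX0; exact: tensor_norm_eq0.
  (* Multiplying by |A X| > 0 and expanding its left occurrence by A = A B A leaves |A (B (A X))| <=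
     |A| |B| |A X|. *)
  rewrite -(ler_pM2r Y0) mul1r -mulrA -{1}ABA !einstein_appM.
  apply: le_trans (tensor_norm_app _ _) _.
  by rewrite ler_wpM2l ?(spectral_norm_ge0 _ U1) ?tensor_norm_app.
have -> : 4 * numerical_radius A * numerical_radius B =
    2 * numerical_radius A * (2 * numerical_radius B) by ring.
by apply: ler_pM; rewrite ?(spectral_norm_ge0 _ U1) ?(spectral_norm_le _ U1).
Qed.
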